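(* Let $\Delta$ be a simplicial complex on $[n]$ and $p$ an integer. Then $H^{-p}L(\Delta)$ is zero if and only if $\tilde H_{p-1}(\Delta_R)$ is zero for all $R\subseteq[n]$.
   Context: $k$ is a field, $[n]=\{1,\dots,n\}$. A simplicial complex on a finite set is a family of subsets closed under taking subsets (the empty family and $\{\emptyset\}$ are both allowed). $\Delta_R=\{F\in\Delta: F\subseteq R\}$. $\tilde H_*$ is reduced simplicial homology over $k$, with $\tilde H_{-1}(\{\emptyset\})=k$ and zero homology for the empty family. $S=k[x_1,\dots,x_n]$. $L(\Delta)$ is the complex of free graded $S$-modules with $L^{-p}(\Delta)=\bigoplus_{I\in\Delta,\,|I|=p}S\,u_I$ in cohomological degree $-p$, where $u_I$ has the multidegree of $\prod_{i\in I}x_i$, and with differential $u_{\{i_1<\dots<i_p\}}\mapsto\sum_j(-1)^{j-1}x_{i_j}u_{\{i_1,\dots,i_p\}\setminus\{i_j\}}$. *)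

(* Defs.v *)
From HB Require Import structures.
From mathcomp Require Import all_boot all_order all_algebra.
From mathcomp Require Import boolp mpoly.

Set Implicit Arguments.
Unset Strict Implicit.
Unset Printing Implicit Defensive.

Import GRing.Theory.

Local Open Scope ring_scope.
Local Open Scope quotient_scope.

Section Homology.
Variables (R : comNzRingType) (U V W : lmodType R).
Variables (f : {linear U -> V}) (g : {linear V -> W}).

Definition kernel : {pred V} := fun z => g z == 0.

Fact kernel_submod : submod_closed kernel.
Proof.
split=> [|a x y]; rewrite !unfold_in ?linear0 //= linearP.
by move=> /eqP-> /eqP->; rewrite scaler0 addr0.
Qed.
HB.instance Definition _ := GRing.isSubmodClosed.Build R V kernel kernel_submod.

Definition cycles := {z : V | z \in kernel}.
HB.instance Definition _ := SubChoice.on cycles.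
HB.instance Definition _ := [SubChoice_isSubLmodule of cycles by <:].

Definition boundaries : {pred cycles} := fun z => `[< exists y, f y = val z >].

Fact boundaries_submod : submod_closed boundaries.
Proof.
split=> [|a x y]; rewrite !unfold_in.
  by apply/asboolP; exists 0; rewrite !linear0.
move=> /asboolP[u fu] /asboolP[v fv]; apply/asboolP; exists (a *: u + v).
by rewrite linearP fu fv linearP.
Qed.
HB.instance Definition _ :=
  GRing.isSubmodClosed.Build R cycles boundaries boundaries_submod.

(* The homology at V of U -f-> V -g-> W, as an R-module; it is meant for
   g \o f = 0, as in `Ldiff_comp` and `rboundary_comp`
   below for the complexes considered here. *)
Definition homology := Quotient.quot boundaries.
HB.instance Definition _ := GRing.Zmodule.on homology.

Definition homology_scale (a : R) (h : homology) : homology :=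
  \pi_(Quotient.quot boundaries) (a *: repr h).

Lemma homology_scale_pi a (z : cycles) :
  homology_scale a (\pi_(Quotient.quot boundaries) z)
    = \pi_(Quotient.quot boundaries) (a *: z).
Proof.
apply/eqP; rewrite /homology_scale -Quotient.idealrBE -scalerBr rpredZ //.
by rewrite Quotient.idealrBE reprK.
Qed.

Lemma homology_repr (h : homology) :
  exists z, h = \pi_(Quotient.quot boundaries) z.
Proof. by exists (repr h); rewrite reprK. Qed.

Fact homology_scaleA a b h :
  homology_scale a (homology_scale b h) = homology_scale (a * b) h.
Proof. by have [z ->] := homology_repr h; rewrite !homology_scale_pi scalerA. Qed.

Fact homology_scale1 : left_id 1 homology_scale.
Proof. by move=> h; have [z ->] := homology_repr h; rewrite homology_scale_pi scale1r. Qed.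

Fact homology_scaleDr : right_distributive homology_scale +%R.
Proof.
move=> a h1 h2; have [x ->] := homology_repr h1; have [y ->] := homology_repr h2.
by rewrite -raddfD !homology_scale_pi scalerDr raddfD.
Qed.

Fact homology_scaleDl h : {morph homology_scale^~ h : a b / a + b}.
Proof. by move=> a b; have [z ->] := homology_repr h; rewrite !homology_scale_pi scalerDl raddfD. Qed.

HB.instance Definition _ := GRing.Zmodule_isLmodule.Build R homology
  homology_scaleA homology_scale1 homology_scaleDr homology_scaleDl.

End Homology.

Definition is_zero (V : nmodType) : Prop := forall v : V, v = 0.

(* The set [n] is 'I_n; both set0 and [set set0] are simplicial complexes. *)
Definition simplicial_complex (n : nat) (Delta : {set {set 'I_n}}) : Prop :=
  forall F G : {set 'I_n}, F \in Delta -> G \subset F -> G \in Delta.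

(* Delta_R; `Delta ::&: R` is [set F in Delta | F \subset R]. *)
Definition restriction (n : nat) (Delta : {set {set 'I_n}}) (R : {set 'I_n}) :
  {set {set 'I_n}} := Delta ::&: R.

(* L(Delta) and the augmented oriented chain complex of Delta have the same
   shape: a free module on faces with u_F |-> \sum_j (-1)^(j-1) w_(i_j) u_(F\i_j),
   where w_i = x_i for the former and w_i = 1 for the latter. *)
Section FaceModules.
Variables (A : comNzRingType) (n : nat) (w : 'I_n -> A) (Delta : {set {set 'I_n}}).

Definition face (m : int) := {F : {set 'I_n} | (F \in Delta) && (#|F|%:Z == m)}.

Definition chain (m : int) := {ffun face m -> A^o}.
HB.instance Definition _ m := GRing.Lmodule.on (chain m).

(* The basis element u_F of `chain m`, and 0 when F is not a face with
   m elements. *)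
Definition gen (m : int) (F : {set 'I_n}) : chain m :=
  [ffun G : face m => (val G == F)%:R].

(* The exponent is the number j - 1 of elements of F preceding i = i_j. *)
Definition diff_gen (m : int) (F : {set 'I_n}) : chain m :=
  \sum_(i in F) ((-1) ^+ #|[set j in F | (j < i)%N]| * w i) *: gen m (F :\ i).

(* Only used for m' = m - 1. Keeping m' free avoids transports between
   propositionally equal degrees; by the convention on `gen`, the map is 0 for
   the other values of m'. *)
Definition diff (m m' : int) (c : chain m) : chain m' :=
  \sum_(F : face m) (c F : A) *: diff_gen m' (val F).

Fact diff_is_linear m m' : linear (@diff m m').
Proof.
move=> a x y; rewrite /diff scaler_sumr -big_split /=; apply: eq_bigr => F _.
by rewrite !ffunE scalerDl scalerA.
Qed.
HB.instance Definition _ m m' :=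
  GRing.isLinear.Build A (chain m) (chain m') *:%R (@diff m m')
    (@diff_is_linear m m').

Lemma diff_genE m m' (F : {set 'I_n}) :
  F \in Delta -> #|F|%:Z = m -> diff m' (gen m F) = diff_gen m' F.
Proof.
move=> FD Fm; have Fp : (F \in Delta) && (#|F|%:Z == m) by rewrite FD Fm eqxx.
rewrite /diff (bigD1 (exist _ F Fp)) //= ffunE eqxx scale1r big1 ?addr0 // => G.
by rewrite -val_eqE /= => GF; rewrite ffunE (negPf GF) scale0r.
Qed.

Lemma diffK m1 m m2 (c : chain m1) :
  m1 = m + 1 -> simplicial_complex Delta -> diff m2 (diff m c) = 0.
Proof.
move=> m1E sc; rewrite {2}/diff linear_sum big1 // => F _; rewrite linearZ /=.
suff ->: diff m2 (diff_gen m (val F)) = 0 by rewrite scaler0.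
case: F => F /= /andP[FD /eqP Fm]; pose e (G : {set 'I_n}) (i : 'I_n) := #|[set j in G | (j < i)%N]|.
have dE i : i \in F -> diff m2 (gen m (F :\ i)) = diff_gen m2 (F :\ i).
  move=> iF; apply: diff_genE; first exact: sc FD (subsetDl _ _).
  by move: Fm; rewrite m1E (cardsD1 i F) iF add1n -addn1 PoszD => /addIr.
pose t (i j : 'I_n) := ((-1) ^+ e F i * w i) *: (((-1) ^+ e (F :\ i) j * w j)
  *: gen m2 (F :\ i :\ j)).
have tN i j : i \in F -> j \in F -> (i < j)%N -> t j i = - t i j.
  move=> iF jF ij; rewrite /t !scalerA -scaleNr !setDDl setUC; congr (_ *: _).
  have -> : e (F :\ j) i = e F i.
    apply: eq_card => l; rewrite !inE; case: (eqVneq l j) => [->|] //=.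
    by rewrite ltnNge (ltnW ij) andbF.
  have -> : e F j = (e (F :\ i) j).+1.
    rewrite /e (cardsD1 i) inE iF ij add1n; congr _.+1.
    by apply: eq_card => l; rewrite !inE andbA.
  by rewrite exprS mulN1r !mulNr mulrACA [in RHS]mulrACA [w j * w i]mulrC
             [_ ^+ e F i * _]mulrC.
rewrite /diff_gen linear_sum /=.
rewrite (eq_bigr (fun i : 'I_n => \sum_(j in F | (i < j)%N) t i j
                         + \sum_(j in F | (j < i)%N) t i j)); last first.
  move=> i iF; rewrite linearZ /= dE // scaler_sumr.
  rewrite (bigID (fun j : 'I_n => (i < j)%N)) /=; congr (_ + _);
    apply: eq_bigl => j; rewrite !inE -val_eqE /=; case: (j \in F);
    by rewrite ?andbT ?andbF //=; case: ltngtP.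
rewrite big_split /= (exchange_big_dep (mem F)) /=; last by move=> i j _ /andP[].
rewrite -big_split big1 //= => j jF.
apply/eqP; rewrite addr_eq0 -sumrN; apply/eqP.
apply: eq_big => i; rewrite jF //= => /andP[iF ij].
by rewrite (tN i j) ?opprK.
Qed.

End FaceModules.

(* The S-module L^d(Delta), S = k[x_1,...,x_n]: its basis consists of the u_I with
   I in Delta and #|I| = - d. The multigrading is not recorded: it
   does not affect the underlying S-module of the cohomology. *)
Definition Lmod (k : fieldType) (n : nat) (Delta : {set {set 'I_n}}) (d : int) :=
  chain {mpoly k[n]} Delta (- d).

Definition Ldiff (k : fieldType) (n : nat) (Delta : {set {set 'I_n}}) (d d' : int) :
    {linear Lmod k Delta d -> Lmod k Delta d'} :=
  @diff {mpoly k[n]} n (fun i => 'X_i) Delta (- d) (- d').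

Lemma Ldiff_comp (k : fieldType) (n : nat) (Delta : {set {set 'I_n}}) (d : int) c :
  simplicial_complex Delta -> Ldiff k Delta d (d + 1) (Ldiff k Delta (d - 1) d c) = 0.
Proof. by apply: diffK; rewrite opprB addrC. Qed.

(* H^d L(Delta). *)
Definition Lcohomology (k : fieldType) (n : nat) (Delta : {set {set 'I_n}})
    (d : int) : lmodType {mpoly k[n]} :=
  homology (Ldiff k Delta (d - 1) d) (Ldiff k Delta d (d + 1)).

(* Reduced chains: q-dimensional faces, that is, those with q + 1 elements. *)
Definition rchain (k : fieldType) (n : nat) (Delta : {set {set 'I_n}}) (q : int) :=
  chain k Delta (q + 1).

Definition rboundary (k : fieldType) (n : nat) (Delta : {set {set 'I_n}})
    (q q' : int) : {linear rchain k Delta q -> rchain k Delta q'} :=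
  @diff k n (fun=> 1) Delta (q + 1) (q' + 1).

Lemma rboundary_comp (k : fieldType) (n : nat) (Delta : {set {set 'I_n}})
    (q : int) c :
  simplicial_complex Delta ->
  rboundary k Delta q (q - 1) (rboundary k Delta (q + 1) q c) = 0.
Proof. exact: diffK. Qed.

Definition reduced_homology (k : fieldType) (n : nat) (Delta : {set {set 'I_n}})
    (q : int) : lmodType k :=
  homology (rboundary k Delta (q + 1) q) (rboundary k Delta q (q - 1)).

(* Main.v *)
(* In multidegree a, the complex L(Delta) has the k-basis x^(a - F) u_F, where F
   runs over the faces contained in R = supp a, and the factors x_i of its
   differential are absorbed by these monomials: this graded piece is the
   augmented chain complex of Delta_R, shifted by one. Every R is the support of
   some a, and a chain has finitely many multidegrees. *)
Require Import Defs.
From mathcomp Require Import all_boot all_order all_algebra.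
From mathcomp Require Import boolp mpoly.

Set Implicit Arguments.
Unset Strict Implicit.
Unset Printing Implicit Defensive.

Import GRing.Theory.

Local Open Scope ring_scope.
Local Open Scope quotient_scope.

Lemma homology_is_zeroP (R : comNzRingType) (U V W : lmodType R)
    (f : {linear U -> V}) (g : {linear V -> W}) :
  is_zero (homology f g) <-> (forall z, g z = 0 -> exists y, f y = z).
Proof.
pose B := Quotient.quot (@boundaries R U V W f g).
have pi0 z : \pi_B z = 0 <-> (exists y, f y = val z).
  rewrite -[X in _ = X](raddf0 \pi_B); split=> [/eqP | ?].
    by rewrite -Quotient.idealrBE subr0 => /asboolP.
  by apply/eqP; rewrite -Quotient.idealrBE subr0; apply/asboolP.
split=> [H0 z gz | ex h].
  have zP : z \in kernel g by rewrite unfold_in gz.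
  by apply/(pi0 (exist _ z zP)).
by have [z ->] := homology_repr h; apply/pi0/ex/eqP/(valP z).
Qed.

Section Coefficients.
Variables (A : comNzRingType) (n : nat) (w : 'I_n -> A) (Delta : {set {set 'I_n}}).

(** Taking the value 0 off the faces with [m] elements lets one set [F] index chains of both Delta
    and its restrictions. *)
Definition fcoef m (c : chain A Delta m) (F : {set 'I_n}) : A :=
  oapp (fun G => c G : A) 0 (insub F).

Lemma fcoef_val m (c : chain A Delta m) (F : face Delta m) : fcoef c (val F) = c F.
Proof. by rewrite /fcoef valK. Qed.

Lemma fcoef_notin m (c : chain A Delta m) F : F \notin Delta -> fcoef c F = 0.
Proof. by move=> FN; rewrite /fcoef insubN // (negPf FN). Qed.

Lemma fcoef0 m F : fcoef (0 : chain A Delta m) F = 0.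
Proof. by rewrite /fcoef; case: insub => //= G; rewrite ffunE. Qed.

Lemma fcoefE m (c : chain A Delta m) F :
  fcoef c F = \sum_(G : face Delta m | val G == F) c G.
Proof.
rewrite /fcoef; case: insubP => [G _ <- | FN] /=.
  by rewrite (eq_bigl (pred1 G)) ?big_pred1_eq // => H; rewrite val_eqE.
by rewrite big1 // => G /eqP GF; move: FN; rewrite -GF (valP G).
Qed.

Definition sign_add (G : {set 'I_n}) (i : 'I_n) : A :=
  (-1) ^+ #|[set j in i |: G | (j < i)%N]|.

(** The differential is read at the target: the pairs with F \ i = G and i in F are exactly those
    with F = G + i and i outside G. *)
Lemma diffE m m' (c : chain A Delta m) (G : face Delta m') :
  diff w m' c G =
  \sum_(i | i \notin val G) sign_add (val G) i * w i * fcoef c (i |: val G).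
Proof.
under eq_bigr do rewrite fcoefE mulr_sumr big_mkcond.
rewrite exchange_big /diff sum_ffunE /=; apply: eq_bigr => F _.
rewrite ffunE sum_ffunE scaler_sumr big_mkcond [RHS]big_mkcond /=.
apply: eq_bigr => i _; rewrite !ffunE.
rewrite -if_and.
have -> : (i \notin val G) && (val F == i |: val G) =
          (i \in val F) && (val G == val F :\ i).
  apply/andP/andP=> [[iG /eqP->] | [iF /eqP->]].
    by rewrite setU11 setU1K.
  by rewrite setD11 setD1K.
case: (boolP (i \in val F)) => //= iF; case: eqP => [->|_]; last by rewrite !scaler0.
by rewrite /sign_add setD1K // [RHS]mulrC scalerA [LHS]mulr1.
Qed.

Lemma fcoef_diff m m' (c : chain A Delta m) G :
  (G \in Delta) && (#|G|%:Z == m') ->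
  fcoef (diff w m' c) G =
  \sum_(i | i \notin G) sign_add G i * w i * fcoef c (i |: G).
Proof. by move=> GP; rewrite -[G]/(val (exist _ G GP : face Delta m')) fcoef_val diffE. Qed.

End Coefficients.

Lemma mpoly_signE (A : comNzRingType) n (e : nat) :
  (-1) ^+ e = ((-1) ^+ e)%:MP :> {mpoly A[n]}.
Proof. by rewrite rmorph_sign. Qed.

(** x_i divides every monomial of ['X_i * q], but not x^b. *)
Lemma mcoeffXM_eq0 (A : comNzRingType) n (i : 'I_n) (q : {mpoly A[n]}) (b : 'X_{1..n}) :
  b i = 0%N -> ('X_i * q)@_b = 0.
Proof.
move=> bi; rewrite (mpolyE q) mulr_sumr raddf_sum big1 //= => m _.
rewrite -scalerAr -mpolyXD mcoeffZ mcoeffX; case: eqP => [E|]; last by rewrite mulr0.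
by move: bi; rewrite -E mnmDE mnm1E eqxx.
Qed.

Section Multidegree.
Variables (k : fieldType) (n : nat) (Delta : {set {set 'I_n}}) (a : 'X_{1..n}).

Definition msupport : {set 'I_n} := [set i | a i != 0%N].

Local Notation DeltaR := (restriction Delta msupport).
Local Notation X := (fun i : 'I_n => 'X_i : {mpoly k[n]}).

(** [mesym1 F] is the multidegree of u_F, with entries 0 and 1. *)
Lemma mesym1_le (F : {set 'I_n}) : (mesym1 F <= a)%MM = (F \subset msupport).
Proof.
apply/mnm_lepP/subsetP=> H i; last first.
  rewrite mnmE; case: (boolP (i \in F)) => // /H.
  by rewrite inE lt0n.
by move=> iF; move: (H i); rewrite mnmE iF inE lt0n.
Qed.

(** This is how x^(a - F) absorbs the factor x_i of the differential. Subtraction of exponents is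
    truncated; the inclusion in supp a makes it exact. *)
Lemma mesym1U1 (F : {set 'I_n}) i : i \notin F -> i |: F \subset msupport ->
  (a - mesym1 F = U_(i) + (a - mesym1 (i |: F)))%MM.
Proof.
rewrite -mesym1_le => iF /mnm_lepP le; apply/mnmP=> j; move: (le j).
rewrite !mnmE !inE eq_sym.
by case: eqVneq => [<-|_] /=; rewrite ?(negPf iF) ?subn0 ?add0n // => ?; rewrite subnKC.
Qed.

(* The isomorphism of the reduced chain complex of Delta_(supp a) with the
   part of L(Delta) of multidegree a: u_F corresponds to x^(a - F) u_F. *)
Definition to_mdeg m (c : chain k DeltaR m) : chain {mpoly k[n]} Delta m :=
  [ffun F => fcoef c (val F) *: 'X_[a - mesym1 (val F)]].

(** Defined on all of L(Delta): it projects to multidegree a, then inverts [to_mdeg]. *)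
Definition of_mdeg m (C : chain {mpoly k[n]} Delta m) : chain k DeltaR m :=
  [ffun F => (fcoef C (val F))@_(a - mesym1 (val F))].

Lemma to_mdeg0 m : to_mdeg (0 : chain k DeltaR m) = 0.
Proof. by apply/ffunP=> F; rewrite !ffunE fcoef0 scale0r. Qed.

Lemma of_mdeg0 m : of_mdeg (0 : chain {mpoly k[n]} Delta m) = 0.
Proof. by apply/ffunP=> F; rewrite !ffunE fcoef0 mcoeff0. Qed.

Lemma fcoef_to_mdeg m (c : chain k DeltaR m) F :
  fcoef (to_mdeg c) F = fcoef c F *: 'X_[a - mesym1 F].
Proof.
rewrite {1}/fcoef; case: insubP => [G _ <- | FN] /=; first by rewrite ffunE.
rewrite /fcoef insubN ?scale0r //; apply: contra FN.
by rewrite inE => /andP[/andP[-> _]].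
Qed.

Lemma fcoef_of_mdeg m (C : chain {mpoly k[n]} Delta m) (F : {set 'I_n}) :
  F \subset msupport -> fcoef (of_mdeg C) F = (fcoef C F)@_(a - mesym1 F).
Proof.
move=> Fa; rewrite {1}/fcoef; case: insubP => [G _ <- | FN] /=.
  by rewrite ffunE.
rewrite /fcoef insubN ?mcoeff0 //; apply: contra FN.
by rewrite inE Fa andbT.
Qed.

Lemma to_mdegK m : cancel (@to_mdeg m) (@of_mdeg m).
Proof.
move=> c; apply/ffunP=> F; rewrite ffunE fcoef_to_mdeg fcoef_val.
by rewrite mcoeffZ mcoeffX eqxx mulr1.
Qed.

Lemma diff_to_mdeg m m' (c : chain k DeltaR m) :
  diff X m' (to_mdeg c) = to_mdeg (diff (fun=> 1) m' c).
Proof.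
apply/ffunP=> G; rewrite diffE ffunE.
(* The formula also holds at faces G of Delta outside supp a: no set containing G lies in Delta_R,
   so both sides vanish. *)
have -> : fcoef (diff (fun=> 1) m' c) (val G) =
  \sum_(i | i \notin val G) sign_add k (val G) i * fcoef c (i |: val G).
  have /andP[GD Gm] := valP G.
  case: (boolP (val G \subset msupport)) => Ga.
    rewrite fcoef_diff ?inE ?GD ?Ga //.
    by apply: eq_bigr => i _; rewrite mulr1.
  have notR (H : {set 'I_n}) : val G \subset H -> H \notin DeltaR.
    by move=> GH; rewrite inE negb_and (contra (subset_trans GH)) ?orbT.
  rewrite fcoef_notin ?notR // big1 // => i _.
  by rewrite fcoef_notin ?mulr0 // notR // subsetUr.
rewrite scaler_suml; apply: eq_bigr => i iG; rewrite fcoef_to_mdeg.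
case: (boolP (i |: val G \in DeltaR)) => [|?].
  rewrite inE => /andP[_ iGa].
  rewrite (mesym1U1 iG iGa) mpolyXD /sign_add mpoly_signE -mulrA mul_mpolyC.
  by rewrite -scalerAr scalerA.
by rewrite fcoef_notin // mulr0 !scale0r mulr0.
Qed.

Lemma diff_of_mdeg m m' (C : chain {mpoly k[n]} Delta m) :
  diff (fun=> 1) m' (of_mdeg C) = of_mdeg (diff X m' C).
Proof.
apply/ffunP=> G; rewrite diffE ffunE.
have /andP[] := valP G; rewrite inE => /andP[GD Ga] Gm.
rewrite fcoef_diff ?GD // raddf_sum /=.
apply: eq_bigr => i iG; rewrite mulr1 /sign_add mpoly_signE -mulrA mul_mpolyC.
rewrite mcoeffZ; congr (_ * _).
case: (boolP (i |: val G \subset msupport)) => iGa.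
  rewrite fcoef_of_mdeg // (mesym1U1 iG iGa).
  by rewrite mulrC mcoeffMX.
(* Here i is outside supp a, so x^(a - G) does not involve x_i and is no monomial of a multiple of
   x_i. *)
rewrite fcoef_notin; last by rewrite inE (negPf iGa) andbF.
rewrite mcoeffXM_eq0 // mnmBE; move: iGa.
by rewrite subUset sub1set Ga andbT inE negbK => /eqP->.
Qed.

End Multidegree.

Lemma sum_mdeg (k : fieldType) n (Delta : {set {set 'I_n}}) m
    (C : chain {mpoly k[n]} Delta m) :
  exists s : seq 'X_{1..n}, C = \sum_(a <- s) to_mdeg (of_mdeg a C).
Proof.
(* These are the multidegrees b + F of the terms x^b u_F of C, each listed once. *)
exists (undup (flatten [seq [seq (b + mesym1 (val F))%MM | b <- msupp (C F)]
                       | F <- enum {: face Delta m}])).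
set s := undup _; apply/ffunP=> F; apply/mpolyP=> b.
pose cF := (C F)@_b; rewrite sum_ffunE raddf_sum /=.
(* The term x^b u_F is seen only by the summand a = b + F. *)
rewrite (eq_bigr (fun a => if a == (b + mesym1 (val F))%MM then cF else 0)).
  rewrite -big_mkcond; case: (boolP (b + mesym1 (val F) \in s)%MM) => [bs|bs].
    by rewrite -big_filter filter_pred1_uniq ?undup_uniq // big_seq1.
  rewrite big1_seq => [|a /andP[/eqP->]]; last by rewrite (negPf bs).
  rewrite /cF memN_msupp_eq0 //; apply: contra bs => bC.
  rewrite mem_undup; apply/flatten_mapP; exists F; first by rewrite mem_enum.
  by apply/mapP; exists b.
move=> a _; rewrite ffunE mcoeffZ mcoeffX.
case: (boolP (val F \subset msupport a)) => Fa.
  rewrite fcoef_of_mdeg // fcoef_val; move: Fa; rewrite -mesym1_le => Fa.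
  have -> : (a == (b + mesym1 (val F))%MM) = (a - mesym1 (val F) == b)%MM.
    apply/eqP/eqP=> [->|<-]; first by rewrite addmK.
    by rewrite submK.
  by case: eqP => [->|_]; rewrite ?mulr1 ?mulr0.
(* If F is not inside supp a, the summand is zero at F, and a = b + F is impossible. *)
rewrite fcoef_notin ?mul0r; last by rewrite inE (negPf Fa) andbF.
case: eqP => // aE; move: Fa; rewrite -mesym1_le aE.
by case/mnm_lepP=> i; rewrite mnmDE leq_addl.
Qed.

Definition exact_at (A : comNzRingType) n (w : 'I_n -> A) Delta (m1 m m2 : int) :=
  forall c : chain A Delta m, diff w m2 c = 0 ->
  exists b : chain A Delta m1, diff w m b = c.

Lemma exact_at_restrictions (k : fieldType) n (Delta : {set {set 'I_n}}) (m1 m m2 : int) :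
  exact_at (fun i => 'X_i : {mpoly k[n]}) Delta m1 m m2 <->
  (forall R, exact_at (fun=> 1 : k) (restriction Delta R) m1 m m2).
Proof.
split=> [LH R | RH C dC].
  (* R is the support of its own squarefree multidegree, so a cycle of Delta_R can be moved into
     L(Delta), bounded there and projected back. *)
  have <- : msupport (mesym1 R) = R.
    by apply/setP=> i; rewrite inE mnmE; case: (i \in R).
  move=> c dc; have [|B dB] := LH (to_mdeg c).
    by rewrite diff_to_mdeg dc to_mdeg0.
  by exists (of_mdeg (mesym1 R) B); rewrite diff_of_mdeg dB to_mdegK.
(* Boundaries are closed under sums, so each multidegree can be treated alone. *)
have [s ->] := sum_mdeg C.
pose bd D := exists B : chain _ Delta m1, diff (fun i => 'X_i : {mpoly k[n]}) m B = D.
apply: (big_ind bd) => [|D1 D2 [B1 <-] [B2 <-]|a _].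
- by exists 0; rewrite linear0.
- by exists (B1 + B2); rewrite linearD.
have [|b <-] := RH (msupport a) (of_mdeg a C).
  by rewrite diff_of_mdeg dC of_mdeg0.
by exists (to_mdeg b); rewrite diff_to_mdeg.
Qed.

Theorem corollary3p8 (k : fieldType) (n : nat) (Delta : {set {set 'I_n}}) (p : int) :
  simplicial_complex Delta ->
  is_zero (Lcohomology k Delta (- p)) <->
  (forall R : {set 'I_n}, is_zero (reduced_homology k (restriction Delta R) (p - 1))).
Proof.
move=> _.
have LE : is_zero (Lcohomology k Delta (- p)) <->
    exact_at (fun i => 'X_i : {mpoly k[n]}) Delta (- (- p - 1)) (- - p) (- (- p + 1)).
  exact: homology_is_zeroP.
have RE R : is_zero (reduced_homology k (restriction Delta R) (p - 1)) <->
    exact_at (fun=> 1 : k) (restriction Delta R)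
      (p - 1 + 1 + 1) (p - 1 + 1) (p - 1 - 1 + 1).
  exact: homology_is_zeroP.
(* Both triples of degrees become p + 1, p, p - 1: faces with p elements have cohomological degree
   -p and dimension p - 1. *)
rewrite LE opprB opprD !opprK [1 + p]addrC exact_at_restrictions.
by split=> H R; move: (H R); rewrite RE !subrK.
Qed.
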